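(* Under the standing setup below (in either the constant or the nonconstant case), if $n\le\frac{t-1}{2}$ and $q>(6n d_1)^{\frac{2t+2}{t-2n}}$, then the system $\sum_{i=1}^t a_{ji}X_i^{d_i}=g_j(X_1,\dots,X_k)$, $1\le j\le n$, has at least one solution in $\mathbb F_q^t$.
   Context: Standing setup: $\mathbb F_q$ is a finite field with $q$ elements. Let $t,n,k$ be positive integers with $1\le k\le n$, and let $d_1>d_2>\cdots>d_t\ge 2$ be integers none divisible by the characteristic of $\mathbb F_q$. Let $A=(a_{ji})\in\mathbb F_q^{n\times t}$ satisfy hypothesis (H): every $n\times n$ submatrix of $A$ (formed by any choice of $n$ columns) has rank $n$. Let $g_1,\dots,g_n\in\mathbb F_q[X_1,\dots,X_k]$ be such that either (constant case) $g_j\in\mathbb F_q$ for all $j$, or (nonconstant case) $0\le\deg g_j<d_t$ for all $j$ and $\deg g_i>0$ for some $i$. *)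

(* Defs.v *)
From HB Require Import structures.
From mathcomp Require Import all_boot all_order all_algebra all_field.
From mathcomp Require Export mpoly.
Set Implicit Arguments. Unset Strict Implicit. Unset Printing Implicit Defensive.
Import Order.TTheory GRing.Theory.
Local Open Scope ring_scope.

(* total degree of a multivariate polynomial: deg p = msize p - 1 for p != 0;
   "deg p < D" is rendered as (msize p <= D) and "deg p > 0" as (1 < msize p). *)

Definition hypH (F : fieldType) (n t : nat) (A : 'M[F]_(n, t)) : Prop :=
  forall f : 'I_n -> 'I_t, injective f -> \rank (colsub f A) = n.

Definition g_cases (F : fieldType) (n k dt : nat) (g : 'I_n -> {mpoly F[k]}) : Prop :=
  (forall j, exists c : F, g j = c%:MP)
  \/ ((forall j, (msize (g j) <= dt)%N) /\ (exists i, (1 < msize (g i))%N)).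

(* x : F^t is a solution of sum_i a_{ji} X_i^{d_i} = g_j(X_1,...,X_k), 1 <= j <= n.
   Indices are 0-based: X_{i+1} ~ x i, d_{i+1} ~ d i. *)
Definition is_solution (F : fieldType) (n t k : nat) (hk : (k <= t)%N)
    (d : nat -> nat) (A : 'M[F]_(n, t)) (g : 'I_n -> {mpoly F[k]})
    (x : 'I_t -> F) : Prop :=
  forall j : 'I_n,
    \sum_(i < t) A j i * x i ^+ d i = (g j).@[fun l : 'I_k => x (widen_ord hk l)].

(* Main.v *)
(** Split the variables into x (the k variables occurring in the g_j) and y (the
    remaining r = t - k >= n + 1), and write the system as u(x) + B y^e = 0.
    With an additive character psi of F, q^n times the number of solutions is the
    sum over l in F^n of S(l) T(l), where S(l) = sum_x psi(l u(x)) and T(l) is a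
    product of one-variable sums; the term l = 0 is q^t.  Nothing is needed about
    an individual S(l): by Cauchy-Schwarz the other terms are controlled by two
    second moments.  The one of S counts pairs with u(x) = u(x'), and the fibres
    of u have at most d_1^k points because deg g_j < d_i.  The one of T comes from
    |sum_y psi(c y^e)|^2 <= e(e-1)q for c <> 0 and from hypothesis (H), which
    bounds the number of l orthogonal to a given set of columns.  This yields a
    solution as soon as q^(t-2n) > d_1^(2t-k). *)
Require Import Defs.
From HB Require Import structures.
From mathcomp Require Import all_boot all_order all_fingroup all_algebra all_field.
From mathcomp Require Import all_character.
From mathcomp Require Import mpoly zify ring.
Set Implicit Arguments. Unset Strict Implicit. Unset Printing Implicit Defensive.
Import Order.TTheory GRing.Theory Num.Theory.
Local Open Scope ring_scope.

(** * Additive characters and their orthogonality *)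

Definition unitary_char (V : zmodType) (psi : V -> algC) : Prop :=
  (forall x y, psi (x + y) = psi x * psi y) /\ (forall x, `|psi x| = 1).

Lemma unitary_char_neq0 (V : zmodType) (psi : V -> algC) (hpsi : unitary_char psi) x :
  psi x != 0.
Proof. by rewrite -normr_eq0 hpsi.2 oner_eq0. Qed.

Lemma unitary_char0 (V : zmodType) (psi : V -> algC) (hpsi : unitary_char psi) :
  psi 0 = 1.
Proof.
by apply: (mulfI (unitary_char_neq0 hpsi 0)); rewrite -hpsi.1 addr0 mulr1.
Qed.

Lemma unitary_charB (V : zmodType) (psi : V -> algC) (hpsi : unitary_char psi) x y :
  psi (x - y) = psi x * (psi y)^*.
Proof.
rewrite hpsi.1; congr (_ * _).
apply: (mulfI (unitary_char_neq0 hpsi y)).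
by rewrite -hpsi.1 subrr unitary_char0 // -normCK hpsi.2 expr1n.
Qed.

Lemma unitary_char_sum (V : zmodType) (psi : V -> algC) (hpsi : unitary_char psi)
    (I : finType) (f : I -> V) : psi (\sum_i f i) = \prod_i psi (f i).
Proof. by apply: (big_morph psi hpsi.1 (unitary_char0 hpsi)). Qed.

Lemma sum_unitary_char (V : finZmodType) (psi : V -> algC) (a : V)
    (hpsi : unitary_char psi) : psi a != 1 -> \sum_x psi x = 0.
Proof.
move=> ha; apply/eqP; have /eqP : psi a * \sum_x psi x = \sum_x psi x.
  rewrite mulr_sumr [RHS](reindex_inj (addrI a)).
  by apply: eq_bigr => x _; rewrite hpsi.1.
by rewrite -{2}[\sum_x _]mul1r -subr_eq0 -mulrBl mulf_eq0 subr_eq0 (negPf ha).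
Qed.

(** An abelian group has only linear irreducible characters, as many as it has elements; the witness
    [v] makes this number exceed one. *)
Lemma nontrivial_unitary_char (V : finZmodType) (v : V) (hv : v != 0) :
  exists psi : V -> algC, unitary_char psi /\ exists a, psi a != 1.
Proof.
have abV : abelian [set: V] by apply: FinRing.zmod_abelian.
have lin (i : Iirr [set: V]) : 'chi_i \is a linear_char by apply/char_abelianP.
have N1 : (1 < Nirr [set: V])%N.
  rewrite NirrE; move: abV; rewrite card_classes_abelian => /eqP ->.
  by rewrite cardsT; apply/card_gt1P; exists 0, v; rewrite eq_sym.
have [i hi] : exists i : Iirr [set: V], i != 0.
  by exists ord_max; rewrite -val_eqE /= -lt0n.
exists (fun x : V => 'chi_i x); split.
  split=> [x y|x]; last by apply: normC_lin_char => //; rewrite inE.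
  by rewrite -lin_charM ?inE.
apply/existsP; apply: contraR hi; rewrite negb_exists => /forallP h.
rewrite -irr_eq1; apply/eqP/cfunP => x; rewrite cfun1E inE.
by apply/eqP; rewrite -[_ == _]negbK; apply: h.
Qed.

(** Expanding the squared modulus gives a sum over pairs of [e l (u x - u y)]; orthogonality keeps
    exactly the pairs in one fibre of [u]. The index [l] is abstract so that it can be a scalar or a
    row vector. *)
Lemma parseval (L X : finType) (V : zmodType) (e : L -> V -> algC) (u : X -> V)
    (he : forall l, unitary_char (e l))
    (orth : forall v, v != 0 -> \sum_l e l v = 0) :
  \sum_l `|\sum_x e l (u x)| ^+ 2
    = (#|L| * \sum_x #|[set y | u y == u x]|)%:R.
Proof.
transitivity (\sum_x \sum_y \sum_l e l (u x - u y)).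
  transitivity (\sum_l \sum_x \sum_y e l (u x - u y)).
    apply: eq_bigr => l _; rewrite normCK rmorph_sum big_distrlr /=.
    by apply: eq_bigr => x _; apply: eq_bigr => y _; rewrite unitary_charB.
  by rewrite exchange_big; apply: eq_bigr => x _; rewrite exchange_big.
rewrite big_distrr natr_sum; apply: eq_bigr => x _ /=.
rewrite (bigID (fun y => u y == u x)) /= [X in _ + X]big1 ?addr0; last first.
  by move=> y hy; apply: orth; rewrite subr_eq0 eq_sym.
rewrite (eq_bigr (fun=> #|L|%:R)) => [|y /eqP ->]; last first.
  rewrite subrr (eq_bigr (fun=> 1)) => [|l _]; last exact: unitary_char0.
  by rewrite sumr_const.
by rewrite sumr_const natrM mulr_natr cardsE.
Qed.

(** * Power sums in one variable *)

Lemma card_power_fiber (F : finFieldType) (d : nat) (v : F) (hd : (0 < d)%N) :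
  (#|[set y : F | y ^+ d == v]| <= d)%N.
Proof.
have hp : ('X^d - v%:P : {poly F}) != 0.
  by rewrite -size_poly_eq0 size_XnsubC.
rewrite cardE -ltnS -(size_XnsubC v hd); apply: max_poly_roots => //.
  by apply/allP => y; rewrite mem_enum inE rootE !hornerE subr_eq0.
exact: enum_uniq.
Qed.

(* The sum depends on c only modulo d-th powers, so its square is at most the
   average of the squares over a class, which Parseval evaluates. *)
Lemma gauss_sum_bound (F : finFieldType) (psi : F -> algC) (d : nat) (a c : F)
    (hpsi : unitary_char psi) (ha : psi a != 1) (hd : (0 < d)%N) (hc : c != 0) :
  `|\sum_x psi (c * x ^+ d)| ^+ 2 <= (d * d.-1 * #|F|)%:R.
Proof.
have q1 := finNzRing_gt1 F; set q := #|F| in q1 *.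
pose T (b : F) := `|\sum_x psi (b * x ^+ d)| ^+ 2.
have cardF : #|[pred b : F | b != 0]| = q.-1.
  by have := cardC1 (0 : F); rewrite /q => <-; apply: eq_card.
have Tall : \sum_b T b <= (q * (1 + q.-1 * d))%:R.
  rewrite (parseval (e := fun b v => psi (b * v)) (fun x => x ^+ d)).
  - rewrite ler_nat leq_mul2l; apply/orP; right.
    (* The fibre of the power map through 0 is a single point; each of the others has at most d
       points. *)
    rewrite (bigD1 0) //= leq_add //.
      rewrite expr0n gtn_eqF //= -(cards1 (0 : F)); apply: subset_leq_card.
      by apply/subsetP => y; rewrite !inE expf_eq0 => /andP [].
    rewrite -cardF -sum_nat_const leq_sum // => x _.
    exact: card_power_fiber.
  - by move=> l; split=> [x y|x]; rewrite ?mulrDr ?hpsi.1 ?hpsi.2.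
  - move=> v hv; apply: (@sum_unitary_char _ (fun b => psi (b * v)) (a / v)).
      by split=> [x y|x]; rewrite ?mulrDl ?hpsi.1 ?hpsi.2.
    by rewrite divfK.
have Tz : T 0 = (q ^ 2)%:R.
  rewrite /T (eq_bigr (fun=> 1)) => [|x _]; last by rewrite mul0r unitary_char0.
  by rewrite sumr_const normr_nat natrX.
(* Removing the term at 0 leaves q (1 + (q - 1) d) - q^2 = q (q - 1) (d - 1). *)
have Tnz : \sum_(b | b != 0) T b <= (q * (q.-1 * d.-1))%:R.
  move: Tall; rewrite (bigD1 0) //= => Tall; rewrite -(lerD2l (T 0)) (le_trans Tall) //.
  rewrite Tz -natrD ler_nat.
  by move: q1 hd; nia.
(* Substituting b x for x shows [T (c * b ^+ d) = T c] for nonzero b, and b -> c b^d takes each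
   value at most d times. *)
have orbit : q.-1%:R * T c <= d%:R * \sum_(b | b != 0) T b.
  have -> : q.-1%:R * T c = \sum_(b : F | b != 0) T (c * b ^+ d).
    rewrite (eq_bigr (fun=> T c)); first by rewrite sumr_const cardF mulr_natl.
    move=> b hb; rewrite /T; congr (`|_| ^+ 2).
    rewrite [RHS](reindex_inj (mulfI hb)) /=.
    apply: eq_bigr => x _; congr psi.
    by rewrite exprMn mulrA.
  rewrite (partition_big (fun b : F => c * b ^+ d) (fun b => b != 0)) /=; last first.
    by move=> b hb; rewrite mulf_neq0 // expf_neq0.
  rewrite mulr_sumr; apply: ler_sum => b hb.
  rewrite (eq_bigr (fun=> T b)) => [|y /andP [_ /eqP ->] //].
  rewrite sumr_const -[leLHS]mulr_natl ler_wpM2r ?exprn_ge0 // ler_nat.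
  rewrite (leq_trans _ (card_power_fiber (b / c) hd)) // subset_leq_card //.
  apply/subsetP => y; rewrite !inE => /andP [_ /eqP <-].
  by rewrite mulrC mulKf.
have q0 : 0 < q.-1%:R :> algC by rewrite ltr0n; lia.
rewrite -(ler_pM2l q0) (le_trans orbit) //.
apply: le_trans (ler_wpM2l _ Tnz) _; first exact: ler0n.
by rewrite -!natrM ler_nat; apply/eq_leq; lia.
Qed.

(** * The Cauchy-Schwarz inequality *)

Lemma norm_sum_CauchySchwarz (R : numDomainType) (I : finType) (P : pred I) (a b : I -> R) :
  `|\sum_(i | P i) a i * b i| ^+ 2
    <= (\sum_(i | P i) `|a i| ^+ 2) * (\sum_(i | P i) `|b i| ^+ 2).
Proof.
have le1 : `|\sum_(i | P i) a i * b i| ^+ 2 <= (\sum_(i | P i) `|a i| * `|b i|) ^+ 2.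
  rewrite ler_sqr ?nnegrE ?sumr_ge0 // => [|i _]; last by rewrite mulr_ge0.
  by apply: le_trans (ler_norm_sum _ _ _) _; apply: ler_sum => i _; rewrite normrM.
(* Lagrange's identity: twice the difference of the two sides is the sum over all pairs i, j of the
   squares of |a_i||b_j| - |a_j||b_i|. *)
apply: le_trans le1 _; rewrite -(ler_pMn2r (n := 2)) // expr2 !big_distrlr /=.
rewrite [leRHS]mulr2n [X in _ <= _ + X]exchange_big /= -big_split.
rewrite -sumrMnl; apply: ler_sum => i _; rewrite -sumrMnl -big_split /=.
apply: ler_sum => j _.
rewrite -subr_ge0.
have -> : `|a i| ^+ 2 * `|b j| ^+ 2 + `|a j| ^+ 2 * `|b i| ^+ 2
    - `|a i| * `|b i| * (`|a j| * `|b j|) *+ 2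
    = (`|a i| * `|b j| - `|a j| * `|b i|) ^+ 2 by ring.
by rewrite real_exprn_even_ge0 // rpredB ?rpredM ?normr_real.
Qed.

(** * Size of the fibres, by reduction of polynomials *)

(** The product over i of 1 - (X_i - a_i)^(q-1) is the indicator of the point [a], because z^(q-1) =
    1 for every nonzero z. *)
Lemma finite_field_interpolation (F : finFieldType) (k : nat)
    (f : {ffun 'I_k -> F} -> F) :
  exists p : {mpoly F[k]}, forall x : {ffun 'I_k -> F}, p.@[x] = f x.
Proof.
have delta (z : F) : 1 - z ^+ #|F|.-1 = (z == 0)%:R.
  have q1 : (0 < #|F|.-1)%N by have := finNzRing_gt1 F; case: #|F| => [|[]].
  have [-> | z0] := eqVneq z 0; first by rewrite expr0n gtn_eqF ?subr0 ?eqxx.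
  suff -> : z ^+ #|F|.-1 = 1 by rewrite subrr.
  by apply: (mulfI z0); rewrite -exprS prednK ?expf_card ?mulr1 // (leq_trans q1) ?leq_pred.
exists (\sum_a f a *: \prod_i (1 - ('X_i - (a i)%:MP) ^+ #|F|.-1)) => x.
rewrite rmorph_sum /= (bigD1 x) //= [X in _ + X]big1 ?addr0 => [|a hax]; last first.
  rewrite mevalZ rmorph_prod /=.
  have [i hi] : exists i, a i != x i.
    by apply/existsP; apply: contraR hax; rewrite negb_exists => /forallP h;
       apply/eqP/ffunP => i; apply/eqP; rewrite -[_ == _]negbK.
  rewrite (bigD1 i) //= rmorphB rmorph1 rmorphXn rmorphB /= mevalXU mevalC delta.
  by rewrite subr_eq0 eq_sym (negPf hi) mul0r mulr0.
rewrite mevalZ rmorph_prod /= big1 ?mulr1 // => i _.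
by rewrite rmorphB rmorph1 rmorphXn rmorphB /= mevalXU mevalC delta subrr eqxx.
Qed.

(* On Z every monomial reduces to monomials with all exponents < D, and every
   function on Z is polynomial: hence q ^ #|Z| <= q ^ (D ^ k). *)
Lemma card_reducible_points (F : finFieldType) (k D : nat) (dd : 'I_k -> nat)
    (h : 'I_k -> {mpoly F[k]}) (Z : {set {ffun 'I_k -> F}})
    (hD : forall i, (dd i <= D)%N) (hm : forall i, (msize (h i) <= dd i)%N)
    (hZ : forall x, x \in Z -> forall i, x i ^+ dd i = (h i).@[x]) :
  (#|Z| <= D ^ k)%N.
Proof.
pose box := {ffun 'I_k -> 'I_D}.
pose ev (c : {ffun box -> F}) (x : {ffun 'I_k -> F}) :=
  \sum_e c e * \prod_i x i ^+ e i.
pose red (m : 'X_{1..k}) :=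
  exists c, forall x, x \in Z -> \prod_i x i ^+ m i = ev c x.
have red_poly (p : {mpoly F[k]}) : (forall m, m \in msupp p -> red m) ->
    exists c, forall x, x \in Z -> p.@[x] = ev c x.
  move=> hp.
  suff [c hc] : exists c, forall x, x \in Z ->
      \sum_(m <- msupp p) p@_m * \prod_i x i ^+ m i = ev c x.
    by exists c => x xZ; rewrite mevalE hc.
  elim: (msupp p : seq _) hp => [|m s IH] hp.
    exists [ffun=> 0] => x _; rewrite big_nil /ev big1 // => e _.
    by rewrite ffunE mul0r.
  have [|c hc] := IH; first by move=> m' hm'; apply: hp; rewrite inE hm' orbT.
  have [c' hc'] := hp m (mem_head _ _).
  exists [ffun e => p@_m * c' e + c e] => x xZ.
  rewrite big_cons hc // hc' // /ev mulr_sumr -big_split /=.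
  by apply: eq_bigr => e _; rewrite ffunE mulrDl mulrA.
have redP m : red m.
  move: {2}(mdeg m).+1 (ltnSn (mdeg m)) => N; elim: N m => // N IH m hN.
  have [/forallP small | ] := boolP [forall i, m i < D]%N.
    pose e0 : box := [ffun i => Ordinal (small i)].
    exists [ffun e => (e == e0)%:R] => x _.
    rewrite /ev (bigD1 e0) //= ffunE eqxx mul1r [X in _ + X]big1 ?addr0.
      by apply: eq_bigr => i _; rewrite ffunE.
    by move=> e /negPf he; rewrite ffunE he mul0r.
  rewrite negb_forall => /existsP [i]; rewrite -leqNgt => hi.
  (* As [dd i <= D <= m i], the monomial contains x_i^(dd i). On [Z] this factor may be replaced by
     [h i], and [msize (h i) <= dd i] makes every resulting monomial smaller in total degree. *)
  pose m1 := (U_(i) *+ dd i)%MM; pose m' := (m - m1)%MM.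
  have mE : m = (m1 + m')%MM.
    apply/mnmP => j; rewrite mnmDE mnmBE mulmnE mnmE.
    by case: eqVneq => [<- | _]; rewrite ?mul1n ?mul0n; have := hD i; lia.
  have [|c hc] := red_poly (h i * 'X_[m']).
    move=> m''; rewrite (perm_mem (msuppMX _ _)) => /mapP [m2 hm2 ->]; apply: IH.
    have := msize_mdeg_lt hm2; have := hm i.
    move: hN; rewrite mE !mdegD mdegMn mdeg1; lia.
  exists c => x xZ; rewrite -hc // rmorphM /= mevalX -hZ // mE.
  rewrite (eq_bigr (fun j => x j ^+ m1 j * x j ^+ m' j)) => [|j _]; last first.
    by rewrite mnmDE exprD.
  rewrite big_split (bigD1 i) //= [X in _ * X * _]big1 => [|j hj].
    by rewrite mulr1 mulmnE mnmE eqxx mul1n.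
  by rewrite mulmnE mnmE eq_sym (negPf hj) mul0n.
pose Phi (c : {ffun box -> F}) : {ffun {x | x \in Z} -> F} := [ffun z => ev c (val z)].
have surj f : f \in codom Phi.
  (* Extended by 0 outside [Z], [f] is interpolated by a polynomial, whose reduction agrees with [f]
     on [Z]. *)
  pose f' x := if insub x is Some z then f z else 0.
  have [p hp] := finite_field_interpolation f'.
  have [|c hc] := red_poly p; first by move=> m _; apply: redP.
  apply/codomP; exists c; apply/ffunP => z.
  by rewrite ffunE -hc ?(valP z) // hp /f' valK.
have : (#|{ffun {x | x \in Z} -> F}| <= #|{ffun box -> F}|)%N.
  apply: leq_trans (leq_image_card Phi _); apply: subset_leq_card.
  by apply/subsetP => f _; apply: surj.
by rewrite !card_ffun !card_ord card_sig leq_exp2l // finNzRing_gt1.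
Qed.

(** Multiplying by the left inverse [C] expresses each x_i^(dd i) on the fibre as a polynomial of
    degree below [dd i], so the bound for reducible points applies. *)
Lemma card_fiber_diagonal_perturbation (F : finFieldType) (n k D dt : nat)
    (dd : 'I_k -> nat) (A : 'M[F]_(n, k)) (C : 'M[F]_(k, n))
    (g : 'I_n -> {mpoly F[k]}) (v : 'cV[F]_n) (hC : C *m A = 1%:M)
    (hD : forall i, (dd i <= D)%N) (hdt : forall i, (dt <= dd i)%N)
    (hg : forall j, (msize (g j) <= dt)%N) (hdt0 : (0 < dt)%N) :
  (#|[set x : {ffun 'I_k -> F} |
      (A *m (\col_i x i ^+ dd i) - \col_j (g j).@[x] == v)%R]| <= D ^ k)%N.
Proof.
pose h i : {mpoly F[k]} := \sum_j C i j *: (g j + (v j 0)%:MP).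
apply: (card_reducible_points (dd := dd) (h := h)) => // [i | x].
  apply: leq_trans (hdt i).
  apply: (leq_trans (msize_sum _ _ _)); apply/bigmax_leqP => j _.
  apply: leq_trans (msizeZ_le _ _) _; apply: leq_trans (msizeD_le _ _) _.
  by rewrite geq_max hg msizeC; case: (_ != 0).
rewrite inE subr_eq => /eqP hx i.
pose w : 'cV[F]_k := \col_i x i ^+ dd i.
have -> : x i ^+ dd i = mulmx C (mulmx A w) i 0 by rewrite mulmxA hC mul1mx mxE.
rewrite hx mxE /h rmorph_sum; apply: eq_bigr => j _ /=.
by rewrite mevalZ mevalD mevalC !mxE addrC.
Qed.

(** * Second moment of the diagonal part *)

(** List the columns with those in [Z] first. The first n of them form an invertible matrix, so [l]
    is determined by its products with these, of which only n - |Z| (truncated at 0) are free. *)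
Lemma card_annihilator (F : finFieldType) (n r : nat) (B : 'M[F]_(n, r))
    (hB : hypH B) (hnr : (n <= r)%N) (Z : {set 'I_r}) :
  (#|[set l : 'rV[F]_n | [forall i in Z, (l *m B)%R 0%R i == 0%R]]|
     <= #|F| ^ (n - #|Z|))%N.
Proof.
pose s := enum Z ++ enum (~: Z).
have size_s : size s = r by rewrite size_cat -!cardE cardsC card_ord.
have uniq_s : uniq s.
  rewrite cat_uniq !enum_uniq andbT /=; apply/hasPn => i.
  by rewrite !mem_enum inE.
pose f (i : 'I_n) := nth (widen_ord hnr i) s i.
have lt_s (i : 'I_n) : (i < size s)%N by rewrite size_s (leq_trans (ltn_ord i)).
have f_inj : injective f.
  move=> i j /eqP; rewrite /f (set_nth_default (widen_ord hnr i)) //.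
  by rewrite nth_uniq // => /eqP /val_inj.
have fZ (i : 'I_n) : (i < #|Z|)%N -> f i \in Z.
  by rewrite cardE => hi; rewrite /f nth_cat hi -mem_enum mem_nth.
have unitM : colsub f B \in unitmx by rewrite -row_full_unit /row_full hB.
have hj (j : 'I_(n - #|Z|)) : (#|Z| + j < n)%N by rewrite -ltn_subRL.
pose phi (l : 'rV[F]_n) :=
  [ffun j : 'I_(n - #|Z|) => (l *m B) 0 (f (Ordinal (hj j)))].
rewrite -(card_in_imset (f := phi)) => [|l1 l2]; last first.
  rewrite !inE => /'forall_implyP h1 /'forall_implyP h2 /ffunP h.
  apply: (can_inj (mulmxK unitM)); rewrite !mulmx_colsub.
  apply/rowP => i; rewrite [LHS]mxE [RHS]mxE.
  case: (ltnP i #|Z|) => hi.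
    by rewrite (eqP (h1 _ (fZ _ hi))) (eqP (h2 _ (fZ _ hi))).
  have hk : (i - #|Z| < n - #|Z|)%N by rewrite ltn_sub2r // (leq_ltn_trans hi).
  have := h (Ordinal hk); rewrite !ffunE.
  by have -> : Ordinal (hj (Ordinal hk)) = i by apply: val_inj; rewrite /= subnKC.
by rewrite (leq_trans (max_card _)) // card_ffun card_ord.
Qed.

(** Expand the product over the subsets J of indices where the first summand is chosen. At most
    q^(n-|J|) vectors survive, each contributing q^(2|J|) (K q)^(r-|J|), so J accounts for at most
    q^(n+r) K^(r-|J|); summing over J gives (1 + K)^r. *)
Lemma annihilator_moment (F : finFieldType) (n r K : nat) (B : 'M[F]_(n, r))
    (hB : hypH B) (hnr : (n <= r)%N) :
  (\sum_(l : 'rV[F]_n | l != 0%R)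
      \prod_(i < r) (((l *m B)%R 0%R i == 0%R) * #|F| ^ 2 + K * #|F|)
    <= #|F| ^ (n + r) * (1 + K) ^ r)%N.
Proof.
set q := #|F|.
have q1 : (1 < q)%N by apply: finNzRing_gt1.
under eq_bigr => l _ do rewrite bigA_distr.
rewrite exchange_big /=.
have -> : ((1 + K) ^ r = \sum_(J in {set 'I_r}) K ^ #|~: J|)%N.
  rewrite -[X in (_ ^ X)%N]card_ord -prod_nat_const bigA_distr /=.
  apply: eq_bigr => J _.
  rewrite (bigID (mem J)) /= big1 ?mul1n => [|i -> //].
  rewrite (eq_bigr (fun=> K)) => [|i /negPf -> //].
  by rewrite prod_nat_const; congr (_ ^ _)%N; apply: eq_card => i; rewrite !inE.
rewrite big_distrr /=; apply: leq_sum => J _.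
pose zero (l : 'rV[F]_n) := [forall i in J, (l *m B) 0 i == 0].
have cJ : (#|J| + #|~: J| = r)%N by rewrite cardsC card_ord.
apply: (@leq_trans (\sum_(l : 'rV[F]_n | (l != 0%R) && zero l)
    q ^ (2 * #|J|) * (K * q) ^ #|~: J|)%N).
  rewrite [leqLHS](bigID zero) /= [X in (_ + X)%N]big1 ?addn0 => [|l]; last first.
    case/andP => _; rewrite negb_forall => /existsP [i].
    rewrite negb_imply => /andP [iJ hi].
    by rewrite (bigD1 i) //= iJ (negPf hi) mul0n.
  apply: leq_sum => l /andP [_ /forallP hl].
  rewrite (bigID (mem J)) /= leq_mul //.
    rewrite expnM -prod_nat_const; apply: leq_prod => i iJ.
    by rewrite iJ; case: (_ == _); rewrite ?mul1n.
  rewrite (eq_bigr (fun=> K * q)%N) => [|i /negPf -> //].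
  rewrite prod_nat_const; apply/eq_leq; congr (_ ^ _)%N.
  by apply: eq_card => i; rewrite !inE.
rewrite sum_nat_const.
have cardJ := card_annihilator hB hnr J; rewrite -/q in cardJ.
set N := #|_|.
have hN : (N * q ^ #|J| <= q ^ n)%N.
  case: (leqP n #|J|) => hJ; last first.
    rewrite -(subnK (ltnW hJ)) expnD leq_mul2r; apply/orP; right.
    apply: leq_trans cardJ; apply: subset_leq_card; apply/subsetP => l.
    by rewrite !inE => /andP [].
  (* For |J| >= n the annihilator has at most one element, and the zero vector is already in it. *)
  suff -> : N = 0 by [].
  apply: eq_card0 => l; rewrite !inE; apply/negP => /andP [l0 zl].
  move: cardJ; rewrite (eqP hJ) expn0 leqNgt => /negP; apply.
  apply/card_gt1P; exists l, 0; split; rewrite ?inE //.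
  by apply/'forall_implyP => i _; rewrite mul0mx mxE.
have -> : (N * (q ^ (2 * #|J|) * (K * q) ^ #|~: J|)
   = (N * q ^ #|J|) * (q ^ r * K ^ #|~: J|))%N.
  have -> : (q ^ r = q ^ #|J| * q ^ #|~: J|)%N by rewrite -expnD cJ.
  by rewrite expnMn mul2n -addnn expnD; ring.
by rewrite expnD -(mulnA (q ^ n)%N) leq_mul2r hN orbT.
Qed.

(** A zero coefficient gives a one-variable sum equal to q, a nonzero one a squared modulus of at
    most D (D - 1) q. Hence the previous moment applies with K = D (D - 1), and 1 + K <= D^2. *)
Lemma diagonal_moment (F : finFieldType) (psi : F -> algC) (a : F) (n r D : nat)
    (B : 'M[F]_(n, r)) (e : 'I_r -> nat)
    (hpsi : unitary_char psi) (ha : psi a != 1) (hB : hypH B) (hnr : (n <= r)%N)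
    (he : forall i, (0 < e i <= D)%N) :
  \sum_(l : 'rV[F]_n | l != 0)
      `|\prod_i \sum_y psi ((l *m B) 0 i * y ^+ e i)| ^+ 2
    <= (#|F| ^ (n + r) * D ^ (2 * r))%:R.
Proof.
apply: (@le_trans _ _ (#|F| ^ (n + r) * (1 + D * D.-1) ^ r)%:R); last first.
  rewrite ler_nat leq_mul2l expnM; apply/orP; right.
  (* The inequality 1 + D (D - 1) <= D^2 needs D >= 1, which [he] provides only if there is an
     index. *)
  case: r B e hB hnr he => [|r] B e hB hnr he; first by [].
  by rewrite leq_exp2r //; have := he 0; nia.
apply: le_trans (_ : _ <= (_)%:R) _; last first.
  by rewrite ler_nat; apply: annihilator_moment hB hnr.
rewrite natr_sum; apply: ler_sum => l _.
rewrite normr_prod -prodrXl natr_prod; apply: ler_prod => i _.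
rewrite exprn_ge0 //=; have [-> | hli] := eqVneq; last first.
  have /andP [e0 eD] := he i.
  apply: le_trans (gauss_sum_bound hpsi ha e0 hli) _.
  by rewrite ler_nat mul0n add0n leq_mul2r leq_mul ?orbT // -!subn1 leq_sub2r.
rewrite (eq_bigr (fun=> 1)) => [|x _]; last by rewrite mul0r unitary_char0.
by rewrite sumr_const normr_nat -natrX ler_nat mul1n leq_addr.
Qed.

(** * Existence of a zero by comparing moments *)

Lemma exists_diagonal_perturbation_zero (F : finFieldType) (n k r D : nat)
    (u : {ffun 'I_k -> F} -> 'cV[F]_n) (B : 'M[F]_(n, r)) (e : 'I_r -> nat)
    (hu : forall v, (#|[set x | u x == v]| <= D ^ k)%N)
    (hB : hypH B) (hnr : (n <= r)%N) (he : forall i, (0 < e i <= D)%N)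
    (hq : (#|F| ^ n.*2 * D ^ (k + 2 * r) < #|F| ^ (k + r))%N) :
  exists (x : {ffun 'I_k -> F}) (y : {ffun 'I_r -> F}),
    u x + B *m (\col_i y i ^+ e i) = 0.
Proof.
have [psi [hpsi [a ha]]] := nontrivial_unitary_char (oner_neq0 F).
pose ps (l : 'rV[F]_n) (v : 'cV[F]_n) := psi ((l *m v) 0 0).
have hps l : unitary_char (ps l).
  by split=> [v w|v]; rewrite /ps ?mulmxDr ?mxE ?hpsi.1 ?hpsi.2.
have orth v : v != 0 -> \sum_l ps l v = 0.
  move=> hv; have [i hi] : exists i, v i 0 != 0.
    apply/existsP; apply: contraR hv; rewrite negb_exists => /forallP h.
    by apply/eqP/colP => i; rewrite mxE; apply/eqP; rewrite -[_ == _]negbK.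
  (* The row vector with a / v_i in position i and 0 elsewhere pairs with [v] to give [a], where psi
     is not 1. *)
  apply: (@sum_unitary_char _ (fun l => ps l v) (delta_mx 0 i *m (a / v i 0)%:M)).
    by split=> [l1 l2|l]; rewrite /ps ?mulmxDl ?mxE ?hpsi.1 ?hpsi.2.
  rewrite /ps mul_mx_scalar -scalemxAl -rowE !mxE divfK //.
case: (boolP [exists x, exists y : {ffun 'I_r -> F},
    u x + B *m (\col_i y i ^+ e i) == 0]).
  by move=> /existsP [x /existsP [y /eqP hxy]]; exists x, y.
rewrite negb_exists => /forallP none; exfalso.
pose S l := \sum_x ps l (u x).
pose T (l : 'rV[F]_n) := \prod_i \sum_y psi ((l *m B) 0 i * y ^+ e i).
(* Multiplied out, this is a sum over x and y of character sums at the values of the system, all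
   nonzero by assumption. *)
have total : \sum_l S l * T l = 0.
  transitivity (\sum_x \sum_(y : {ffun 'I_r -> F}) \sum_l
      ps l (u x + B *m (\col_i y i ^+ e i))); last first.
    apply: big1 => x _; apply: big1 => y _; apply: orth.
    by have := none x; rewrite negb_exists => /forallP.
  under [RHS]eq_bigr => x _ do rewrite exchange_big /=.
  rewrite [RHS]exchange_big; apply: eq_bigr => l _ /=.
  rewrite /S /T bigA_distr_bigA big_distrlr /=.
  apply: eq_bigr => x _; apply: eq_bigr => y _.
  rewrite (hps l).1; congr (_ * _).
  rewrite /ps mulmxA mxE unitary_char_sum //.
  by apply: eq_bigr => i _; congr (psi (_ * _)); rewrite mxE.
set q := #|F| in hq.
have q0 : (0 < q)%N by apply: ltnW; apply: finNzRing_gt1.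
have main0 : S 0 * T 0 = (q ^ (k + r))%:R.
  have -> : S 0 = (q ^ k)%:R.
    rewrite /S (eq_bigr (fun=> 1)) => [|x _].
      by rewrite sumr_const card_ffun card_ord.
    by rewrite /ps mul0mx mxE unitary_char0.
  have -> : T 0 = (q ^ r)%:R.
    rewrite /T (eq_bigr (fun=> q%:R)) => [|i _].
      by rewrite prodr_const card_ord natrX.
    rewrite (eq_bigr (fun=> 1)) => [|y _]; first by rewrite sumr_const.
    by rewrite mul0mx mxE mul0r unitary_char0.
  by rewrite -natrM expnD.
have secondS : \sum_(l | l != 0) `|S l| ^+ 2 <= (q ^ n * (q ^ k * D ^ k))%:R.
  apply: (@le_trans _ _ (\sum_l `|S l| ^+ 2)).
    by rewrite [leRHS](bigD1 0) //= lerDr exprn_ge0.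
  rewrite /S (parseval _ hps orth) ler_nat card_mx mul1n leq_mul2l.
  apply/orP; right; rewrite -[X in (X ^ k * _)%N]/q.
  rewrite -[X in (q ^ X * _)%N]card_ord -card_ffun -sum_nat_const.
  by apply: leq_sum => x _.
have := norm_sum_CauchySchwarz (fun l => l != 0) S T.
have -> : \sum_(l | l != 0) S l * T l = - (q ^ (k + r))%:R.
  by apply/eqP; rewrite -addr_eq0 addrC -main0; move/eqP: total; rewrite (bigD1 0).
rewrite normrN normr_nat -natrX => CS.
have : ((q ^ (k + r)) ^ 2)%:R
    <= (q ^ n * (q ^ k * D ^ k) * (q ^ (n + r) * D ^ (2 * r)))%:R :> algC.
  apply: le_trans CS _; rewrite [leRHS]natrM.
  apply: ler_pM secondS _; try by apply: sumr_ge0 => l _; apply: exprn_ge0.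
  exact: diagonal_moment hpsi ha hB hnr he.
(* After cancelling q^(k+r), the inequality reads q^(k+r) <= q^(2n) D^(k+2r), against [hq]. *)
rewrite ler_nat leqNgt => /negP; apply.
have -> : (q ^ n * (q ^ k * D ^ k) * (q ^ (n + r) * D ^ (2 * r))
  = (q ^ n.*2 * D ^ (k + 2 * r)) * q ^ (k + r))%N.
  by rewrite -addnn !expnD; ring.
by rewrite expnS expn1 ltn_pmul2r // expn_gt0 q0.
Qed.

(** * Reduction of the system to a perturbed diagonal one *)

Theorem mainTheorem10 (F : finFieldType) (t n k : nat)
  (ht : (0 < t)%N) (hk1 : (1 <= k)%N) (hkn : (k <= n)%N) (hkt : (k <= t)%N)
  (d : nat -> nat)
  (hdec : forall i j : nat, (i < j)%N -> (j < t)%N -> (d j < d i)%N)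
  (hdt : (2 <= d t.-1)%N)
  (hchar : forall (p i : nat), p \in [pchar F] -> (i < t)%N -> ~~ (p %| d i)%N)
  (A : 'M[F]_(n, t)) (hA : hypH A)
  (g : 'I_n -> {mpoly F[k]}) (hg : g_cases (d t.-1) g)
  (hn : (n.*2 <= t - 1)%N)
  (hq : ((6 * n * d 0%N) ^ (2 * t + 2) < #|F| ^ (t - n.*2))%N) :
  exists x : 'I_t -> F, is_solution hkt d A g x.
Proof.
have [r ?] : exists r, t = (k + r)%N by exists (t - k)%N; rewrite subnKC.
subst t.
have hnt : (n <= k + r)%N by lia.
have hnr : (n <= r)%N by lia.
have d_le i : (i < k + r)%N -> (d (k + r).-1 <= d i <= d 0)%N.
  move=> hi; apply/andP; split.
    have [-> // | ne] := eqVneq i (k + r).-1.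
    by apply/ltnW/hdec; lia.
  by case: i hi => // i hi; apply/ltnW/hdec.
(* The constant and nonconstant cases merge here: a constant has [msize] at most 1, below the last
   exponent. *)
have g_size j : (msize (g j) <= d (k + r).-1)%N.
  case: hg => [/(_ j) [c ->] | [-> //]].
  by rewrite msizeC (leq_trans (leq_b1 _)) // ltnW.
have hB : hypH (rsubmx A).
  move=> f f_inj; rewrite -[RHS](hA (fun i => rshift k (f i))).
    by congr (\rank _); apply/matrixP => i j; rewrite !mxE.
  by move=> i j /rshift_inj /f_inj.
(* The first n columns are invertible by (H); the first k rows of the inverse form a left inverse of
   the first k columns. *)
pose M := colsub (widen_ord hnt) A.
have unitM : M \in unitmx.
  rewrite -row_full_unit; apply/eqP/hA => i j ij; apply: val_inj.
  exact: (congr1 (@nat_of_ord _) ij).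
pose C : 'M[F]_(k, n) := rowsub (widen_ord hkn) (invmx M).
have hC : C *m lsubmx A = 1%:M.
  have -> : lsubmx A = colsub (widen_ord hkn) M.
    by apply/matrixP => i j; rewrite !mxE; congr (A i _); apply: val_inj.
  rewrite -mxsub_mul mulVmx //; apply/matrixP => i j.
  by rewrite !mxE -!val_eqE.
have dk (i : 'I_k) : (d (k + r).-1 <= d i <= d 0)%N.
  by apply: d_le; rewrite (leq_trans (ltn_ord i)) // leq_addr.
have dr (i : 'I_r) : (0 < d (k + i) <= d 0)%N.
  have /andP [h1 h2] : (d (k + r).-1 <= d (k + i) <= d 0)%N.
    by apply: d_le; rewrite ltn_add2l.
  by rewrite h2 andbT (leq_trans _ h1) // ltnW.
have hu v := card_fiber_diagonal_perturbation (dd := fun i : 'I_k => d i) v hC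
  (fun i => proj2 (andP (dk i))) (fun i => proj1 (andP (dk i))) g_size (ltnW hdt).
have [|x [y hxy]] := exists_diagonal_perturbation_zero hu hB hnr dr.
  have -> : (#|F| ^ (k + r) = #|F| ^ n.*2 * #|F| ^ (k + r - n.*2))%N.
    by rewrite -expnD subnKC //; lia.
  have d0 : (0 < d 0)%N by have := d_le 0 _; lia.
  rewrite ltn_pmul2l ?expn_gt0 ?(ltnW (finNzRing_gt1 F)) //.
  apply: leq_ltn_trans hq.
  (* The required power of [d 0] has exponent k + 2r <= 2t + 2, and d_1 <= 6 n d_1 because n >=
     1. *)
  apply: (@leq_trans ((d 0) ^ (2 * (k + r) + 2))%N).
    by rewrite leq_pexp2l //; lia.
  rewrite leq_exp2r ?addn_gt0 ?orbT //.
  by apply: leq_pmull; rewrite muln_gt0 /=; exact: leq_trans hk1 hkn.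
exists (fun i => match split i with inl a => x a | inr b => y b end) => j.
rewrite big_split_ord /=.
have := congr1 (fun v : 'cV[F]_n => v j 0) hxy.
rewrite !mxE addrAC => /eqP; rewrite subr_eq0 => /eqP hj.
transitivity ((g j).@[x]); last first.
  apply: meval_eq => l.
  have -> : widen_ord hkt l = lshift r l by apply: val_inj.
  by rewrite (unsplitK (inl l)).
rewrite -hj; congr (_ + _); apply: eq_bigr => i _; rewrite !mxE.
  by rewrite (unsplitK (inl i)).
by rewrite (unsplitK (inr i)).
Qed.
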